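(* Let $\mathcal H_1,\mathcal H_2,\mathcal H$ be complex Banach spaces and $\Theta\subset\mathbb C$ open. Suppose that either (1) $\Theta\ni z\mapsto A_z\in\mathcal B(\mathcal H,\mathcal H_2)$ and $\Theta\ni z\mapsto B_z\in\mathcal C(\mathcal H_1,\mathcal H)$ are holomorphic, or (2) $\Theta\ni z\mapsto A_z\in\mathcal C(\mathcal H,\mathcal H_2)$ and $\Theta\ni z\mapsto B_z\in\mathcal C_{\rm inv}(\mathcal H_1,\mathcal H)$ are holomorphic. If in addition $A_zB_z\in\mathcal C(\mathcal H_1,\mathcal H_2)$ for all $z\in\Theta$, then $\Theta\ni z\mapsto A_zB_z$ is holomorphic.
   Context: $\mathcal B(\cdot,\cdot)$ denotes bounded everywhere defined operators, $\mathcal C(\cdot,\cdot)$ closed operators (defined on a linear subspace, not necessarily dense), and $\mathcal C_{\rm inv}(\mathcal H_1,\mathcal H)$ the closed operators that are injective with range equal to $\mathcal H$ (so with bounded everywhere defined inverse). The product $AB$ has domain $\mathrm{Dom}(AB)=\{v\in\mathrm{Dom}(B):Bv\in\mathrm{Dom}(A)\}$. A function $z\mapsto T_z\in\mathcal C(\mathcal H_1,\mathcal H_2)$ is complex differentiable at $z_0\in\Theta$ if there exist an open $\Theta_0$ with $z_0\in\Theta_0\subset\Theta$, a Banach space $\mathcal K$ and bounded injective operators with closed range $R_z:\mathcal K\to\mathcal H_1\oplus\mathcal H_2$, $z\in\Theta_0$, such that $R_z$ is a bijection of $\mathcal K$ onto the graph $\mathrm{Gr}(T_z)=\{(x,T_zx):x\in\mathrm{Dom}(T_z)\}$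 for all $z\in\Theta_0$ and $z\mapsto R_z$ is complex differentiable at $z_0$ in operator norm. It is holomorphic if it is complex differentiable at every point of $\Theta$. For functions with values in bounded everywhere defined operators, holomorphy means the usual norm holomorphy. *)

(* Defs.v *)
From HB Require Import structures.
From mathcomp Require Import all_boot all_order all_algebra.
From mathcomp Require Import complex.
From mathcomp Require Import all_classical all_reals.
From mathcomp Require Import topology normedtype.
Set Implicit Arguments.
Unset Strict Implicit.
Unset Printing Implicit Defensive.
Import Order.TTheory GRing.Theory Num.Theory.
Import numFieldNormedType.Exports.
Local Open Scope classical_set_scope.
Local Open Scope ring_scope.
Local Open Scope complex_scope.

Section Operators.
Context {R : realType}.

(* A linear operator defined on a linear subspace [dom] of [V]. The values of
   [fn] outside [dom] are junk: none of the notions below depends on them. *)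
Record linop (V W : normedModType R[i]) := Linop {
  dom : set V ;
  fn :> V -> W ;
  dom0 : dom 0 ;
  domP : forall (a : R[i]) x y, dom x -> dom y -> dom (a *: x + y) ;
  fnP : forall (a : R[i]) x y, dom x -> dom y ->
    fn (a *: x + y) = a *: fn x + fn y }.

Definition graph (V W : normedModType R[i]) (T : linop V W) : set (V * W) :=
  [set (x, T x) | x in dom T].

Definition closed_op (V W : normedModType R[i]) (T : linop V W) : Prop :=
  closed (graph T).

Definition closed_inv_op (V W : normedModType R[i]) (T : linop V W) : Prop :=
  [/\ closed_op T, set_inj (dom T) T & T @` dom T = [set: W]].

Section Product.
Context {U V W : normedModType R[i]} (A : linop V W) (B : linop U V).

Definition comp_dom : set U := [set v | dom B v /\ dom A (B v)].

Lemma comp_dom0 : comp_dom 0.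
Proof.
have B0 : B 0 = 0.
  have := fnP (-1) (dom0 B) (dom0 B).
  by rewrite scaleN1r addNr => ->; rewrite scaleN1r addNr.
by split; rewrite ?B0; apply: dom0.
Qed.

Lemma comp_domP (a : R[i]) x y :
  comp_dom x -> comp_dom y -> comp_dom (a *: x + y).
Proof.
move=> [Bx Ax] [By Ay]; split; first exact: domP.
by rewrite (fnP _ Bx By); exact: domP.
Qed.

Lemma comp_fnP (a : R[i]) x y : comp_dom x -> comp_dom y ->
  A (B (a *: x + y)) = a *: A (B x) + A (B y).
Proof. by move=> [Bx Ax] [By Ay]; rewrite (fnP _ Bx By) (fnP _ Ax Ay). Qed.

Definition comp_op : linop U W := Linop comp_dom0 comp_domP comp_fnP.

End Product.

Definition bounded_map (V W : normedModType R[i]) (f : V -> W) : Prop :=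
  exists M : R, forall x, `|f x| <= M%:C * `|x|.

Definition bounded_op (V W : normedModType R[i]) (T : linop V W) : Prop :=
  dom T = [set: V] /\ bounded_map T.

(* Norms of complex normed modules take values in R[i] (they are real and
   nonnegative there), hence the [Re]. Meaningful for bounded linear [f]. *)
Definition opnorm (V W : normedModType R[i]) (f : V -> W) : R :=
  sup [set complex.Re `|f x| | x in [set x : V | `|x| <= 1]].

(* R[i]^o is R[i], with the topology given by the modulus. *)
Definition norm_differentiable_at (V W : normedModType R[i])
    (T : R[i] -> V -> W) (z0 : R[i]^o) : Prop :=
  exists D : {linear V -> W}, bounded_map D /\
    opnorm (fun x => (z - z0)^-1 *: (T z x - T z0 x) - D x)
      @[z --> z0^'] --> (0 : R).

Definition norm_holomorphic (V W : normedModType R[i])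
    (Theta : set R[i]^o) (T : R[i] -> linop V W) : Prop :=
  forall z0, Theta z0 -> norm_differentiable_at T z0.

Definition differentiable_at (V W : normedModType R[i])
    (Theta : set R[i]^o) (T : R[i] -> linop V W) (z0 : R[i]^o) : Prop :=
  exists (Theta0 : set R[i]^o) (K : completeNormedModType R[i])
      (r : R[i] -> {linear K -> (V * W)%type}),
    [/\ open Theta0, Theta0 z0, Theta0 `<=` Theta,
        forall z, Theta0 z ->
          [/\ bounded_map (r z), injective (r z), closed (range (r z)) &
              set_bij [set: K] (graph (T z)) (r z)] &
        norm_differentiable_at r z0].

Definition holomorphic (V W : normedModType R[i])
    (Theta : set R[i]^o) (T : R[i] -> linop V W) : Prop :=
  forall z0, Theta z0 -> differentiable_at Theta T z0.

End Operators.

(* Main.v *)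
Require Import Defs.
From HB Require Import structures.
From mathcomp Require Import all_boot all_order all_algebra.
From mathcomp Require Import complex.
From mathcomp Require Import all_classical all_reals.
From mathcomp Require Import topology normedtype.
From mathcomp Require Import ring lra.

(* Resolve [B z] by [q z = (q1 z, q2 z)] and [A z] by [r z = (r1 z, r2 z)],
   each a bounded bijection onto the graph. In case (1), the graph of [A z B z]
   is the image of [k |-> (q1 z k, A z (q2 z k))]. In case (2), [q2 z] is a
   bounded bijection of Banach spaces, so its inverse is bounded and depends
   holomorphically on [z]; hence so does [(B z)^-1 = q1 z \o (q2 z)^-1], and
   the graph of [A z B z] is the image of
   [k |-> ((B z)^-1 (r1 z k), r2 z k)]. In both cases the new map is a
   resolution, its range being closed by the closedness of [A z B z]. *)

Set Implicit Arguments.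
Unset Strict Implicit.
Unset Printing Implicit Defensive.
Import Order.TTheory GRing.Theory Num.Theory.
Import numFieldNormedType.Exports.
Local Open Scope classical_set_scope.
Local Open Scope ring_scope.
Local Open Scope complex_scope.

(** * Real-valued norms, bounded maps and linear maps *)

Section RealNorm.
Context {R : realType}.
Implicit Types U V W : normedModType R[i].

(** Norms in [R[i]] are real, so taking the real part loses nothing and moves all estimates into the
    ordered field [R], where [lra] and [nra] apply. *)
Definition nrm V (x : V) : R := complex.Re `|x|.

Lemma nrmE V (x : V) : `|x| = (nrm x)%:C.
Proof.
have /ger0_Im := normr_ge0 x; rewrite /nrm.
by case: `|x| => a b /= ->.
Qed.

Lemma nrm_ge0 V (x : V) : 0 <= nrm x.
Proof. by rewrite -ler0c -nrmE. Qed.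

Lemma nrmN V (x : V) : nrm (- x) = nrm x.
Proof. by rewrite /nrm normrN. Qed.

Lemma nrmBC V (x y : V) : nrm (x - y) = nrm (y - x).
Proof. by rewrite -nrmN opprB. Qed.

Lemma nrm0 V : nrm (0 : V) = 0.
Proof. by rewrite /nrm normr0. Qed.

Lemma nrm_eq0 V (x : V) : nrm x = 0 -> x = 0.
Proof. by move=> x0; apply/eqP; rewrite -normr_eq0 nrmE x0. Qed.

Lemma nrmD V (x y : V) : nrm (x + y) <= nrm x + nrm y.
Proof. by rewrite -lecR rmorphD /= -!nrmE ler_normD. Qed.

Lemma nrmB V (x y : V) : nrm (x - y) <= nrm x + nrm y.
Proof. by rewrite -(nrmN y) nrmD. Qed.

Lemma nrmBD V (y x z : V) : nrm (x - z) <= nrm (x - y) + nrm (y - z).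
Proof. by rewrite (le_trans _ (nrmD _ _))// addrA subrK. Qed.

(* Scalars live in [R[i]], whose normed module structure is that of [R[i]^o]. *)
Definition cnrm (a : R[i]) : R := nrm (a : R[i]^o).

Lemma cnrm_ge0 a : 0 <= cnrm a.
Proof. exact: nrm_ge0. Qed.

Lemma cnrm0 : cnrm 0 = 0.
Proof. exact: nrm0. Qed.

Lemma nrmZ V (a : R[i]) (x : V) : nrm (a *: x) = cnrm a * nrm x.
Proof.
have : `|a *: x| = `|a : R[i]^o| * `|x| by rewrite normrZ.
by rewrite !nrmE -rmorphM /= => /complexI.
Qed.

Lemma nrmZR V (a : R) (x : V) : 0 <= a -> nrm (a%:C *: x) = a * nrm x.
Proof.
move=> a0; rewrite nrmZ; congr (_ * _).
by rewrite /cnrm /nrm ger0_norm// ler0c.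
Qed.

Lemma nrm_pair V W (x : V) (y : W) c :
  nrm x <= c -> nrm y <= c -> nrm (x, y) <= c.
Proof. by rewrite -!lecR -!nrmE prod_normE /= maxElt => ? ?; case: ifP. Qed.

Lemma nrm_fst V W (p : V * W) : nrm p.1 <= nrm p.
Proof.
rewrite -lecR -!nrmE prod_normE /= comparable_le_max ?lexx//.
by apply: real_comparable; exact: normr_real.
Qed.

Lemma nrm_snd V W (p : V * W) : nrm p.2 <= nrm p.
Proof.
rewrite -lecR -!nrmE prod_normE /= comparable_le_max ?lexx ?orbT//.
by apply: real_comparable; exact: normr_real.
Qed.

Lemma near_nrm V (x : V) (d : R) : 0 < d -> \forall y \near x, nrm (y - x) < d.
Proof.
move=> d0; apply/nbhs_normP; exists d%:C => /=; first by rewrite (ltcR 0).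
by move=> y /=; rewrite -ltcR -nrmE distrC.
Qed.

Lemma bounded_mapP V W (f : V -> W) :
  bounded_map f <-> exists M : R, forall x, nrm (f x) <= M * nrm x.
Proof.
split=> -[M fM]; exists M => x; have := fM x.
  by rewrite !nrmE -rmorphM /= lecR.
by rewrite !nrmE -rmorphM /= lecR.
Qed.

(** The constant in [bounded_map] may be zero or negative; the estimates below divide by it and
    multiply inequalities by it. *)
Lemma bounded_map_gt0 V W (f : V -> W) : bounded_map f ->
  exists2 M : R, 0 < M & forall x, nrm (f x) <= M * nrm x.
Proof.
move=> /bounded_mapP[M fM]; exists (`|M| + 1); first by rewrite ltr_wpDl.
move=> x; rewrite (le_trans (fM x))// ler_wpM2r ?nrm_ge0//.
by rewrite (le_trans (ler_norm M))// lerDl.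
Qed.

Lemma bounded_comp V W (U : normedModType R[i]) (f : W -> U) (g : V -> W) :
  bounded_map f -> bounded_map g -> bounded_map (f \o g).
Proof.
move=> /bounded_map_gt0[M M0 fM] /bounded_map_gt0[N N0 gN].
apply/bounded_mapP; exists (M * N) => x /=.
by rewrite (le_trans (fM _))// -mulrA ler_wpM2l// ltW.
Qed.

Lemma bounded_pair V W (U : normedModType R[i]) (f : V -> W) (g : V -> U) :
  bounded_map f -> bounded_map g -> bounded_map (fun x => (f x, g x)).
Proof.
move=> /bounded_map_gt0[M M0 fM] /bounded_map_gt0[N N0 gN].
apply/bounded_mapP; exists (M + N) => x /=; have x0 := nrm_ge0 x.
by apply: nrm_pair; [apply: (le_trans (fM x))|apply: (le_trans (gN x))]; nra.
Qed.

Lemma bounded_fst V W : bounded_map (@fst V W).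
Proof. by apply/bounded_mapP; exists 1 => x; rewrite mul1r nrm_fst. Qed.

Lemma bounded_snd V W : bounded_map (@snd V W).
Proof. by apply/bounded_mapP; exists 1 => x; rewrite mul1r nrm_snd. Qed.

Lemma bounded_add V W (f g : V -> W) :
  bounded_map f -> bounded_map g -> bounded_map (f \+ g).
Proof.
move=> /bounded_mapP[M fM] /bounded_mapP[N gN]; apply/bounded_mapP.
exists (M + N) => x /=; rewrite mulrDl (le_trans (nrmD _ _))//.
exact: lerD.
Qed.

Lemma bounded_opp V W (f : V -> W) : bounded_map f -> bounded_map (\- f).
Proof.
move=> /bounded_mapP[M fM]; apply/bounded_mapP.
by exists M => x /=; rewrite nrmN.
Qed.

(** Linearity is carried as a predicate on plain functions, because the inverses obtained below by
    choice come without a bundled structure. *)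
Lemma linear_fun0 V W (f : V -> W) : linear f -> f 0 = 0.
Proof. by move=> lf; rewrite -[0](subrr 0) (zmod_morphism_linear lf) subrr. Qed.

Lemma linear_comp_fun U V W (f : V -> W) (g : U -> V) :
  linear f -> linear g -> linear (f \o g).
Proof. by move=> lf lg a x y /=; rewrite lg lf. Qed.

Lemma linear_pair_fun U V W (f : U -> V) (g : U -> W) :
  linear f -> linear g -> linear (fun x => (f x, g x)).
Proof. by move=> lf lg a x y; rewrite lf lg. Qed.

Lemma linear_add_fun V W (f g : V -> W) :
  linear f -> linear g -> linear (f \+ g).
Proof. by move=> lf lg a x y /=; rewrite lf lg scalerDr addrACA. Qed.

Lemma linear_opp_fun V W (f : V -> W) : linear f -> linear (\- f).
Proof. by move=> lf a x y /=; rewrite lf opprD scalerN. Qed.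

Lemma linear_fst V W : linear (@fst V W). Proof. by []. Qed.

Lemma linear_snd V W : linear (@snd V W). Proof. by []. Qed.

End RealNorm.

(** * Baire category and the bounded inverse theorem over the complex numbers *)
Section BoundedInverse.
Context {R : realType}.

(** The second hypothesis says that the closed ball of radius [r n.+1] about [y n.+1] lies in that
    of radius [r n] about [y n]. The centres are therefore Cauchy, and their limit stays in every
    ball. *)
Lemma nested_balls (V : completeNormedModType R[i]) (y : nat -> V)
    (r : nat -> R) : (forall n, 0 <= r n) ->
  (forall n, nrm (y n.+1 - y n) + r n.+1 <= r n) ->
  (forall e, 0 < e -> exists n, r n < e) ->
  exists l, forall n, nrm (l - y n) <= r n.
Proof.
move=> r0 yr re.
(* Keeping the radius on the left makes the induction telescope. *)
have ym n k : nrm (y (k + n)%N - y n) + r (k + n)%N <= r n.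
  elim: k => [|k IH]; first by rewrite add0n subrr nrm0 add0r.
  have := nrmBD (y (k + n)%N) (y (k + n).+1) (y n).
  by have := yr (k + n)%N; rewrite addSn; lra.
have ymn n m : (n <= m)%N -> nrm (y m - y n) <= r n.
  by move=> /subnK <-; have := ym n (m - n)%N; have := r0 (m - n + n)%N; lra.
have : cvg (y @ \oo).
  apply: cauchy_cvg; apply: cauchy_exP => e e0.
  (* A positive element of [R[i]] has zero imaginary part. *)
  have [d d0 ed] : exists2 d : R, 0 < d & e = d%:C.
    exists (complex.Re e); move: e0; rewrite ltcE /= => /andP[/eqP ie re0]//.
    by rewrite [LHS]complexE ie mulr0 addr0.
  have [n rn] := re _ d0; exists (y n), n => // m nm /=.
  rewrite -ball_normE /= ed nrmE ltcR nrmBC.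
  by apply: le_lt_trans rn; exact: ymn.
move=> /cvg_ex[l yl]; exists l => n; apply/ler_addgt0Pr => e e0.
have : \forall m \near \oo, nrm (y m - l) < e.
  exact: (yl _ (near_nrm l e0)).
move=> ye; near \oo => m.
have yml : nrm (y m - l) < e by near: m.
have nm : (n <= m)%N by near: m; exact: nbhs_infty_ge.
have := nrmBD (y m) l (y n); rewrite (nrmBC l (y m)).
by have := ymn _ _ nm; lra.
Unshelve. all: by end_near. Qed.

Lemma half_expn_lt (e : R) : 0 < e -> exists n, 2^-1 ^+ n < e.
Proof.
move=> e0; exists (Num.truncn e^-1).+1.
rewrite exprVn -[ltRHS]invrK ltf_pV2 ?posrE ?exprn_gt0 ?invr_gt0//.
rewrite (lt_trans (truncnS_gt _))// -natrX ltr_nat.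
exact: ltn_expl.
Qed.

(* The library's Baire theorem covers real normed modules only. *)
Lemma baire_cover (V : completeNormedModType R[i]) (E : nat -> set V) :
  \bigcup_n E n = setT ->
  exists n x (d : R), 0 < d /\
    forall y, nrm (y - x) < d ->
      forall e : R, 0 < e -> exists2 z, E n z & nrm (z - y) < e.
Proof.
move=> EV; apply: contrapT => nE.
(* If no [E n] is dense in a ball, each ball contains a smaller one, of at most half the radius,
   whose closure avoids [E n]. The implication makes the statement total, as [choice] requires; a
   nonpositive radius gets a dummy answer. *)
have step (s : nat * (V * R)) : exists t : V * R, 0 < s.2.2 ->
    [/\ 0 < t.2, nrm (t.1 - s.2.1) + t.2 <= s.2.2, t.2 <= 2^-1 * s.2.2 &
      forall z, E s.1 z -> t.2 < nrm (z - t.1)].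
  case: s => n [x d] /=; have [d0|d0] := ltP 0 d; last first.
    by exists (x, d) => /=; rewrite ltNge d0.
  have [y yx [e e0 ye]] : exists2 y, nrm (y - x) < d / 2 &
      exists2 e : R, 0 < e & forall z, E n z -> e <= nrm (z - y).
    apply: contrapT => H; apply: nE; exists n, x, (d / 2); split; first lra.
    move=> y yd e e0; apply: contrapT => K; apply: H; exists y => //.
    exists e => // z Ez; rewrite leNgt; apply/negP => ze.
    by apply: K; exists z.
  (* The bound [e / 2] keeps the closed ball strictly away from [E n]; the bound [d / 2] gives both
     the nesting and the halving. *)
  pose d' := Num.min (e / 2) (d / 2).
  have [d'0 d'e d'd] : [/\ 0 < d', d' <= e / 2 & d' <= d / 2].
    by split; rewrite ?ge_min ?lexx ?orbT// lt_min; lra.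
  exists (y, d') => _ /=; split=> //; [lra|lra|].
  by move=> z /ye; lra.
have [f fP] := choice step.
pose s := fix s n := if n is m.+1 then f (m, s m) else (0 : V, 1 : R).
have s0 n : 0 < (s n).2.
  by elim: n => [|n IH]; [exact: ltr01|case: (fP (n, s n) IH)].
have sP n := fP (n, s n) (s0 n).
have sr n : (s n).2 <= 2^-1 ^+ n.
  elim: n => [|n IH]; first by rewrite expr0.
  by have [_ _ sn _] := sP n; rewrite exprS; move: sn => /= ; lra.
have [|||l ls] := @nested_balls V (fun n => (s n).1) (fun n => (s n).2).
- by move=> n; exact/ltW.
- by move=> n; case: (sP n).
- move=> e /half_expn_lt[n ne]; exists n; exact: le_lt_trans (sr n) ne.
(* The limit belongs to some [E n], yet it also lies in ball [n.+1], which was chosen to avoid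
   [E n]. *)
have : (\bigcup_n E n) l by rewrite EV.
move=> [n _ Enl]; have [_ _ _ /(_ l Enl)] := sP n.
by have := ls n.+1; rewrite /=; lra.
Qed.

(** By surjectivity the images of the balls of radius [n] cover [W], so by Baire one of them is
    dense in some ball. Differences recentre that ball at 0, and scaling reaches every [y]. *)
Lemma almost_open (V W : completeNormedModType R[i]) (f : V -> W) :
  linear f -> (forall y, exists x, f x = y) ->
  exists2 C : R, 0 < C & forall y (e : R), 0 < e ->
    exists2 x, nrm x <= C * nrm y & nrm (y - f x) <= e.
Proof.
move=> lf sf.
have fB := zmod_morphism_linear lf; have fZ := scalable_linear lf.
have [] := @baire_cover W (fun n => f @` [set x | nrm x <= n%:R]).
  rewrite -subTset => y _; have [x <-] := sf y.
  exists (Num.truncn (nrm x)).+1 => //; exists x => //=.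
  exact/ltW/truncnS_gt.
move=> n [y0 [d [d0 H]]].
have n0 : (0 : R) <= n%:R by exact: ler0n.
(* Write [y] as [(y + y0) - y0] and approximate both terms within [e / 2]; the two preimages add up
   to norm at most [2 * n%:R]. *)
have B y (e : R) : nrm y < d -> 0 < e ->
    exists2 x, nrm x <= 2 * n%:R & nrm (y - f x) <= e.
  move=> yd e0; have e20 : 0 < e / 2 by lra.
  have [|_ [x1 /= x1n <-] x1e] := H (y + y0) _ _ e20; first by rewrite addrK.
  have [|_ [x2 /= x2n <-] x2e] := H y0 _ _ e20; first by rewrite subrr nrm0.
  exists (x1 - x2); first by have := nrmB x1 x2; lra.
  rewrite fB.
  have -> : y - (f x1 - f x2) = (f x2 - y0) - (f x1 - (y + y0)).
    by rewrite !opprB addrA [RHS]addrA addrACA addNr addr0 (addrC (f x2)).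
  by have := nrmB (f x2 - y0) (f x1 - (y + y0)); lra.
(* Scaling [y] to norm [d / 2] and back turns [2 * n%:R] into [4 * n%:R / d * nrm y]; the extra 1
   ensures positivity even for [n = 0]. *)
exists (4 * n%:R / d + 1); first by rewrite ltr_wpDl// divr_ge0//; lra.
move=> y e e0; have := nrm_ge0 y; rewrite le_eqVlt.
move=> /predU1P[/esym/nrm_eq0 ->|y0'].
  exists 0; first by rewrite !nrm0 mulr0.
  by rewrite (linear_fun0 lf) subrr nrm0 ltW.
pose t := d / (2 * nrm y).
have t0 : 0 < t by rewrite divr_gt0// mulr_gt0.
have ty : nrm (t%:C *: y) = d / 2.
  by rewrite nrmZR ?ltW// /t; field; lra.
have tyd : nrm (t%:C *: y) < d by rewrite ty; lra.
have [x xn xe] := B _ _ tyd (mulr_gt0 t0 e0).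
have tx z : z = t%:C *: (t^-1%:C *: z) :> V.
  by rewrite scalerA -rmorphM /= divff ?gt_eqF// scale1r.
exists (t^-1%:C *: x).
  rewrite nrmZR ?invr_ge0 ?ltW//.
  have -> : t^-1 = 2 * nrm y / d by rewrite /t; field; lra.
  have k0 : 0 <= 2 * nrm y / d by rewrite divr_ge0//; lra.
  have := ler_wpM2l k0 xn.
  have -> : 2 * nrm y / d * (2 * n%:R) = 4 * n%:R / d * nrm y by ring.
  lra.
by rewrite -(ler_pM2l t0) -(nrmZR _ (ltW t0)) scalerBr -fZ -tx.
Qed.

(** Successive approximation: [almost_open] is applied repeatedly to the residual, which is halved
    each time. The corrections form a geometric series whose sum is a preimage of [y] of norm at
    most [2 * C * nrm y], and injectivity identifies it with [x0]. *)
Lemma bounded_inverse (V W : completeNormedModType R[i]) (f : V -> W) :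
  linear f -> bounded_map f -> injective f -> (forall y, exists x, f x = y) ->
  exists2 C : R, 0 < C & forall x, nrm x <= C * nrm (f x).
Proof.
move=> lf /bounded_map_gt0[M M0 fM] jf sf.
have [C C0 CP] := almost_open lf sf.
have fB := zmod_morphism_linear lf; have f0 := linear_fun0 lf.
have fD u v : f (u + v) = f u + f v by have := lf 1 u v; rewrite !scale1r.
exists (2 * C); first by lra.
move=> x0; set y := f x0; pose a := nrm y.
have := nrm_ge0 y; rewrite le_eqVlt => /predU1P[/esym y0|a0].
  have : f x0 = f 0 by rewrite f0; exact: nrm_eq0.
  by move=> /jf ->; rewrite nrm0 y0 mulr0.
pose h n : R := 2^-1 ^+ n.
have h0 n : 0 < h n by rewrite exprn_gt0 ?invr_gt0.
have hS n : h n.+1 = h n / 2 by rewrite /h exprSr.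
(* The correction [u] approximates the residual [y - f x] within the next tolerance [a * h n.+1], at
   a cost of [C] times the current one. *)
have step (s : nat * V) : exists x', nrm (y - f s.2) <= a * h s.1 ->
    nrm (y - f x') <= a * h s.1.+1 /\ nrm (x' - s.2) <= C * (a * h s.1).
  case: s => n x /=.
  have [u uC ue] := CP (y - f x) (a * h n.+1) (mulr_gt0 a0 (h0 _)).
  exists (x + u) => yx; split; first by rewrite fD opprD addrA.
  by rewrite addrAC subrr add0r (le_trans uC)// ler_pM2l.
have [g gP] := choice step.
pose s := fix s n := if n is m.+1 then g (m, s m) else 0 : V.
have ys n : nrm (y - f (s n)) <= a * h n.
  elim: n => [|n IH]; last by case: (gP (n, s n) IH).
  by rewrite f0 subr0 /h expr0 mulr1.
have ss n : nrm (s n.+1 - s n) <= C * (a * h n).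
  by case: (gP (n, s n) (ys n)).
have Ca : 0 < C * a by rewrite mulr_gt0.
(* The radius is the tail, from index [n] on, of the geometric series with terms [C * a * h k]. *)
have [|||l ls] := @nested_balls V s (fun n => 2 * (C * a) * h n).
- by move=> n; rewrite ltW// !mulr_gt0.
- by move=> n; have := ss n; rewrite hS mulrA; lra.
- move=> e e0; have [|n nP] := @half_expn_lt (e / (2 * (C * a))).
    by rewrite divr_gt0// mulr_gt0.
  by exists n; rewrite mulrC -ltr_pdivlMr// mulr_gt0.
have {}ls n : nrm (l - s n) <= 2 * (C * a) * h n := ls n.
(* Comparing both sides with [f (s n)] bounds the distance by [(a + M * (2 * (C * a))) * h n], which
   is arbitrarily small. *)
have yl : y = f l.
  apply/eqP; rewrite -subr_eq0; apply/eqP/nrm_eq0/eqP.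
  rewrite eq_le nrm_ge0 andbT; apply/ler_addgt0Pr => e e0; rewrite add0r.
  have K0 : 0 < a + M * (2 * (C * a)) by rewrite addr_gt0// !mulr_gt0.
  have [|n nP] := @half_expn_lt (e / (a + M * (2 * (C * a)))).
    by rewrite divr_gt0.
  move: nP; rewrite ltr_pdivlMr// -/(h n) => nP.
  have := nrmBD (f (s n)) y (f l); have := ys n; have := fM (s n - l).
  rewrite fB (nrmBC (s n)); have := ler_wpM2l (ltW M0) (ls n).
  by lra.
(* The sequence starts at 0 and [h 0 = 1], so the radius at index 0 bounds [nrm l] itself. *)
rewrite (jf _ _ yl); have := ls 0%N.
by rewrite subr0 /h expr0 mulr1 mulrA.
Qed.

End BoundedInverse.

(** * Norm derivatives of operator-valued functions *)
Section NormDifferentiability.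
Context {R : realType}.
Implicit Types V W : normedModType R[i].

Lemma opnorm_le V W (f : V -> W) (e : R) : 0 <= e ->
  (forall x, nrm (f x) <= e * nrm x) -> 0 <= opnorm f <= e.
Proof.
move=> e0 fe; set S := [set complex.Re `|f x| | x in [set x : V | `|x| <= 1]].
have S0 : S (nrm (f 0)) by exists 0 => //=; rewrite normr0.
have Se : ubound S e.
  move=> _ [x /= x1 <-]; rewrite (le_trans (fe x))// ler_piMr//.
  by move: x1; rewrite nrmE (lecR _ 1).
rewrite /opnorm -/S; apply/andP; split.
  by apply: (le_trans (nrm_ge0 (f 0))); apply: ub_le_sup => //; exists e.
by apply: ge_sup => //; exists (nrm (f 0)).
Qed.

Lemma le_opnorm V W (f : V -> W) : linear f -> bounded_map f ->
  forall x, nrm (f x) <= opnorm f * nrm x.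
Proof.
move=> lf /bounded_map_gt0[M M0 fM] x.
have fZ := scalable_linear lf; have f0 := linear_fun0 lf.
have := nrm_ge0 x; rewrite le_eqVlt => /predU1P[/esym/nrm_eq0 ->|x0].
  by rewrite f0 !nrm0 mulr0.
have xV0 : 0 <= (nrm x)^-1 by rewrite invr_ge0 ltW.
rewrite -ler_pdivrMr// mulrC -nrmZR// -fZ; apply: ub_le_sup.
  exists M => _ [u /= u1 <-]; rewrite (le_trans (fM u))// ler_piMr ?(ltW M0)//.
  by move: u1; rewrite nrmE (lecR _ 1).
exists ((nrm x)^-1%:C *: x) => //=.
by rewrite nrmE nrmZR// mulVf ?gt_eqF// (lecR 1 1).
Qed.

(* Norm differentiability in epsilon form: unlike [opnorm], it makes sense
   without any boundedness assumption on the [T z]. *)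
Definition has_norm_derivative V W (T : R[i] -> V -> W) (z0 : R[i]^o)
    (D : V -> W) := forall e : R, 0 < e -> \forall z \near z0, forall x,
  nrm (T z x - T z0 x - (z - z0) *: D x) <= e * cnrm (z - z0) * nrm x.

Lemma near_cnrm (z0 : R[i]^o) (d : R) :
  0 < d -> \forall z \near z0, cnrm (z - z0) < d.
Proof. exact: (@near_nrm R R[i]^o z0). Qed.

(** Linearity and boundedness near [z0] make the difference quotient minus [D] a bounded linear map,
    so that its [opnorm] controls it pointwise. *)
Lemma norm_differentiable_has_derivative V W (T : R[i] -> V -> W)
    (z0 : R[i]^o) :
  (\forall z \near z0, linear (T z) /\ bounded_map (T z)) ->
  norm_differentiable_at T z0 ->
  exists D : {linear V -> W}, bounded_map D /\ has_norm_derivative T z0 D.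
Proof.
move=> nT [D [bD cD]]; exists D; split=> // e e0.
have [l0 b0] := nbhs_singleton nT.
have : \forall z \near z0^',
    `|opnorm (fun x => (z - z0)^-1 *: (T z x - T z0 x) - D x)| < e.
  exact: cvgr0_norm_lt cD e e0.
rewrite near_withinE => nD.
(* The limit is over punctured neighbourhoods; at [z0] itself both sides vanish. *)
near=> z => x; have [->|zz0] := eqVneq z z0.
  by rewrite !subrr scale0r subr0 nrm0 cnrm0 mulr0 mul0r.
have h0 : z - z0 != 0 by rewrite subr_eq0.
have : linear (T z) /\ bounded_map (T z) by near: z.
have : z != z0 ->
    `|opnorm (fun x => (z - z0)^-1 *: (T z x - T z0 x) - D x)| < e by near: z.
move=> /(_ zz0) fe [lz bz]; set h := z - z0 in h0 fe *.
pose f x := h^-1 *: (T z x - T z0 x) - D x.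
have lf : linear f.
  move=> a u v; rewrite /f lz l0 linearP opprD addrACA -scalerBr.
  rewrite scalerDr scalerA (mulrC _ a) -scalerA.
  by rewrite opprD addrACA -scalerBr.
have bf : bounded_map f.
  have [M M0 TM] := bounded_map_gt0 bz.
  have [N N0 TN] := bounded_map_gt0 b0.
  have [K K0 DK] := bounded_map_gt0 bD.
  apply/bounded_mapP; exists (cnrm h^-1 * (M + N) + K) => u.
  rewrite mulrDl (le_trans (nrmB _ _))// lerD//.
  rewrite nrmZ -mulrA ler_wpM2l ?cnrm_ge0//.
  by rewrite mulrDl (le_trans (nrmB _ _))// lerD.
have {}fe : opnorm f < e by exact: le_lt_trans (ler_norm _) fe.
have -> : T z x - T z0 x - h *: D x = h *: f x.
  by rewrite /f scalerBr scalerA divff// scale1r.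
rewrite nrmZ (mulrC e) -mulrA ler_wpM2l ?cnrm_ge0//.
by rewrite (le_trans (le_opnorm lf bf x))// ler_wpM2r ?nrm_ge0 ?ltW.
Unshelve. all: by end_near. Qed.

Lemma has_derivative_norm_differentiable V W (T : R[i] -> V -> W)
    (z0 : R[i]^o) (D : V -> W) :
  linear D -> bounded_map D -> has_norm_derivative T z0 D ->
  norm_differentiable_at T z0.
Proof.
move=> lD bD TD.
pose F : {linear V -> W} := HB.pack D (GRing.isLinear.Build _ _ _ _ D lD).
exists F; split=> //; apply/cvgr0Pnorm_le => e e0.
rewrite near_withinE; near=> z => zz0.
have h0 : z - z0 != 0 by rewrite subr_eq0.
(* Multiplicativity of the modulus is [nrmZ] for [R[i]^o] as a module over itself. *)
have hV : cnrm (z - z0)^-1 * cnrm (z - z0) = 1.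
  have := nrmZ ((z - z0)^-1) (z - z0 : R[i]^o).
  by rewrite /GRing.scale /= mulVf// => <-; rewrite /nrm normr1.
have /andP[? ?] :
    0 <= opnorm (fun x => (z - z0)^-1 *: (T z x - T z0 x) - D x) <= e.
  apply: opnorm_le => [|x]; first exact: ltW.
  have -> : (z - z0)^-1 *: (T z x - T z0 x) - D x =
      (z - z0)^-1 *: (T z x - T z0 x - (z - z0) *: D x).
    by rewrite [RHS]scalerBr scalerA mulVf// scale1r.
  have TDx : nrm (T z x - T z0 x - (z - z0) *: D x) <=
      e * cnrm (z - z0) * nrm x.
    by move: x; near: z; exact: TD.
  rewrite nrmZ (le_trans (ler_wpM2l (cnrm_ge0 _) TDx))//.
  by rewrite !mulrA (mulrAC _ e) hV mul1r.
by rewrite ger0_norm.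
Unshelve. all: by end_near. Qed.

Lemma has_norm_derivative_lipschitz V W (T : R[i] -> V -> W) (z0 : R[i]^o)
    (D : V -> W) : bounded_map D -> has_norm_derivative T z0 D ->
  exists2 M : R, 0 < M & \forall z \near z0, forall x,
    nrm (T z x - T z0 x) <= M * cnrm (z - z0) * nrm x.
Proof.
move=> /bounded_map_gt0[M M0 DM] /(_ 1 ltr01) TD.
exists (M + 1); first by rewrite addr_gt0.
near=> z => x.
have H : nrm (T z x - T z0 x - (z - z0) *: D x) <= 1 * cnrm (z - z0) * nrm x.
  by move: x; near: z.
have := nrmD (T z x - T z0 x - (z - z0) *: D x) ((z - z0) *: D x).
rewrite subrK nrmZ; have := ler_wpM2l (cnrm_ge0 (z - z0)) (DM x).
by lra.
Unshelve. all: by end_near. Qed.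

(** * Calculus rules for norm derivatives *)

Lemma has_norm_derivative_near_eq V W (S T : R[i] -> V -> W) (z0 : R[i]^o)
    (D : V -> W) : (\forall z \near z0, S z =1 T z) ->
  has_norm_derivative T z0 D -> has_norm_derivative S z0 D.
Proof.
move=> ST TD e e0; have ST0 := nbhs_singleton ST.
near=> z => x; have -> : S z x = T z x by move: x; near: z.
by rewrite ST0; move: x; near: z; exact: TD.
Unshelve. all: by end_near. Qed.

Lemma has_norm_derivative_cst V W (f : V -> W) (z0 : R[i]^o) :
  has_norm_derivative (fun=> f) z0 (fun=> 0).
Proof.
move=> e e0; near=> z => x.
by rewrite subrr scaler0 subr0 nrm0 !mulr_ge0 ?nrm_ge0 ?cnrm_ge0// ltW.
Unshelve. all: by end_near. Qed.

Lemma has_norm_derivative_pair (U V W : normedModType R[i])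
    (S : R[i] -> U -> V) (T : R[i] -> U -> W) (z0 : R[i]^o)
    (D : U -> V) (E : U -> W) :
  has_norm_derivative S z0 D -> has_norm_derivative T z0 E ->
  has_norm_derivative (fun z x => (S z x, T z x)) z0 (fun x => (D x, E x)).
Proof.
move=> SD TE e e0; near=> z => x; apply: nrm_pair => /=.
  by move: x; near: z; exact: SD.
by move: x; near: z; exact: TE.
Unshelve. all: by end_near. Qed.

Lemma has_norm_derivative_comp (U V W : normedModType R[i])
    (S : R[i] -> V -> W) (T : R[i] -> U -> V) (z0 : R[i]^o)
    (D : V -> W) (E : U -> V) :
  linear (S z0) -> bounded_map (S z0) -> bounded_map (T z0) ->
  linear D -> bounded_map D -> bounded_map E ->
  has_norm_derivative S z0 D -> has_norm_derivative T z0 E ->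
  has_norm_derivative (fun z x => S z (T z x)) z0
    (fun x => D (T z0 x) + S z0 (E x)).
Proof.
move=> lS /bounded_map_gt0[s s0 Ss] /bounded_map_gt0[t t0 Tt].
move=> lD bD bE SD TE.
have [d d0 Dd] := bounded_map_gt0 bD.
have [l l0 Tl] := has_norm_derivative_lipschitz bE TE.
have DB := zmod_morphism_linear lD.
have SB := zmod_morphism_linear lS; have SZ := scalable_linear lS.
move=> e e0.
(* Each of three error terms receives [e / 3]. In [e3], the entry [l^-1] gives [l * cnrm h <= 1],
   hence the bound [t + 1] for [T z]; the other entry handles the second-order term. *)
pose e1 := e / (3 * (t + 1)); pose e2 := e / (3 * s).
pose e3 := Num.min (e / (3 * d * l)) l^-1.
have e10 : 0 < e1 by rewrite divr_gt0// mulr_gt0// addr_gt0.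
have e20 : 0 < e2 by rewrite divr_gt0// mulr_gt0.
have e30 : 0 < e3 by rewrite lt_min !divr_gt0 ?invr_gt0// !mulr_gt0.
near=> z.
have hx : cnrm (z - z0) <= e3 by apply: ltW; near: z; exact: near_cnrm.
have H1 y : nrm (S z y - S z0 y - (z - z0) *: D y) <=
    e1 * cnrm (z - z0) * nrm y.
  by move: y; near: z; exact: SD.
have H2 x : nrm (T z x - T z0 x - (z - z0) *: E x) <=
    e2 * cnrm (z - z0) * nrm x.
  by move: x; near: z; exact: TE.
have H3 x : nrm (T z x - T z0 x) <= l * cnrm (z - z0) * nrm x.
  by move: x; near: z.
move=> x; set h := z - z0 in hx H1 H2 H3 *.
have h0 : 0 <= cnrm h by exact: cnrm_ge0.
have x0 : 0 <= nrm x by exact: nrm_ge0.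
have hl : l * cnrm h <= 1.
  rewrite mulrC -ler_pdivlMr// mul1r (le_trans hx)//.
  by rewrite ge_min lexx orbT.
have hd : d * l * cnrm h <= e / 3.
  rewrite mulrC -ler_pdivlMr ?mulr_gt0//.
  have -> : e / 3 / (d * l) = e / (3 * d * l) by field; rewrite !gt_eqF.
  by rewrite (le_trans hx)// ge_min lexx.
have Tx : nrm (T z x) <= (t + 1) * nrm x.
  have := nrmD (T z x - T z0 x) (T z0 x); rewrite subrK.
  by have := H3 x; have := Tt x; have := ler_wpM2r x0 hl; lra.
(* The error splits into the remainder of [S] at [T z x], the effect of moving the argument of [D]
   from [T z0 x] to [T z x], and the image under [S z0] of the remainder of [T]. *)
have -> : S z (T z x) - S z0 (T z0 x) - h *: (D (T z0 x) + S z0 (E x)) =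
    (S z (T z x) - S z0 (T z x) - h *: D (T z x)) +
    (h *: D (T z x - T z0 x) + S z0 (T z x - T z0 x - h *: E x)).
  rewrite !SB DB SZ scalerBr scalerDr [in RHS]addrA subrKA.
  rewrite opprD [RHS]addrAC -!addrA addKr; congr (_ + (_ + _)).
  exact: addrC.
have B1 := le_trans (H1 (T z x)) (ler_wpM2l (mulr_ge0 (ltW e10) h0) Tx).
have B2 := le_trans (Dd (T z x - T z0 x)) (ler_wpM2l (ltW d0) (H3 x)).
have {B2} := ler_wpM2l h0 B2; rewrite -nrmZ => B2.
have B3 := le_trans (Ss (T z x - T z0 x - h *: E x))
  (ler_wpM2l (ltW s0) (H2 x)).
apply: (le_trans (nrmD _ _)); have := nrmD (h *: D (T z x - T z0 x))
  (S z0 (T z x - T z0 x - h *: E x)).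
have : e1 * cnrm h * ((t + 1) * nrm x) = e / 3 * (cnrm h * nrm x).
  by rewrite /e1; field; rewrite gt_eqF// addr_gt0.
have : s * (e2 * cnrm h * nrm x) = e / 3 * (cnrm h * nrm x).
  by rewrite /e2; field; rewrite gt_eqF.
have := ler_wpM2r (mulr_ge0 h0 x0) hd.
have -> : d * l * cnrm h * (cnrm h * nrm x) =
    cnrm h * (d * (l * cnrm h * nrm x)).
  by ring.
by lra.
Unshelve. all: by end_near. Qed.

(* From [y = f z (g z y) = f z0 (g z0 y)], the derivative of the inverse is
   [- g z0 \o D \o g z0]; the bound on [g z0] gives a uniform one on [g z]. *)
Lemma has_norm_derivative_inverse V W (f : R[i] -> V -> W) (g : R[i] -> W -> V)
    (z0 : R[i]^o) (D : V -> W) :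
  linear (f z0) -> linear (g z0) -> bounded_map (g z0) ->
  linear D -> bounded_map D ->
  cancel (f z0) (g z0) -> (\forall z \near z0, cancel (g z) (f z)) ->
  has_norm_derivative f z0 D ->
  has_norm_derivative g z0 (fun y => - g z0 (D (g z0 y))).
Proof.
move=> lf lg /bounded_map_gt0[c c0 gc] lD bD fK gK fD.
have [d d0 Dd] := bounded_map_gt0 bD.
have [l l0 fl] := has_norm_derivative_lipschitz bD fD.
have DB := zmod_morphism_linear lD.
have gB := zmod_morphism_linear lg; have gZ := scalable_linear lg.
have fB := zmod_morphism_linear lf.
have gK0 := nbhs_singleton gK.
(* Two error terms receive [e / 2] each, computed with [nrm (g z y) <= 2 * c * nrm y]; the entry
   [(2 * c * l)^-1] of [e3] is what yields this bound. *)
move=> e e0; pose e1 := e / (4 * c ^+ 2).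
pose e3 := Num.min (e / (4 * c ^+ 3 * d * l)) (2 * c * l)^-1.
have e10 : 0 < e1 by rewrite divr_gt0// !mulr_gt0// exprn_gt0.
have e30 : 0 < e3.
  by rewrite lt_min divr_gt0 ?invr_gt0 ?mulr_gt0// exprn_gt0.
near=> z.
have hx : cnrm (z - z0) <= e3 by apply: ltW; near: z; exact: near_cnrm.
have gzK : cancel (g z) (f z) by near: z.
have H1 x : nrm (f z x - f z0 x - (z - z0) *: D x) <=
    e1 * cnrm (z - z0) * nrm x.
  by move: x; near: z; exact: fD.
have H2 x : nrm (f z x - f z0 x) <= l * cnrm (z - z0) * nrm x.
  by move: x; near: z; exact: fl.
move=> y; set h := z - z0 in hx H1 H2 *; pose x := g z y.
have h0 : 0 <= cnrm h by exact: cnrm_ge0.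
have y0 : 0 <= nrm y by exact: nrm_ge0.
have x0 : 0 <= nrm x by exact: nrm_ge0.
have hl : c * l * cnrm h <= 1 / 2.
  rewrite mulrC -ler_pdivlMr ?mulr_gt0//.
  have -> : 1 / 2 / (c * l) = (2 * c * l)^-1 by field; rewrite !gt_eqF.
  by rewrite (le_trans hx)// ge_min lexx orbT.
have hd : 4 * c ^+ 3 * d * l * cnrm h <= e.
  rewrite mulrC -ler_pdivlMr ?mulr_gt0// ?exprn_gt0//.
  by rewrite (le_trans hx)// ge_min lexx.
have xE : x - g z0 y = - g z0 (f z x - f z0 x).
  by rewrite gB fK gzK opprB.
have H3 : nrm (x - g z0 y) <= c * (l * cnrm h * nrm x).
  by rewrite xE nrmN (le_trans (gc _))// ler_pM2l.
(* Since [c * l * cnrm h] is at most one half, the term in [nrm x] on the right of [H3] is absorbed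
   on the left. *)
have xy : nrm x <= 2 * c * nrm y.
  have := nrmD (x - g z0 y) (g z0 y); rewrite subrK.
  have := H3; have := gc y; have := ler_wpM2r x0 hl; lra.
(* The first term carries the remainder of [f] at [x]; the second pays for replacing [g z0 y] by [x]
   inside [D]. *)
have -> : g z y - g z0 y - h *: - g z0 (D (g z0 y)) =
    - g z0 (f z x - f z0 x - h *: D x) - h *: g z0 (D (x - g z0 y)).
  rewrite -/x [in LHS]xE scalerN opprK; move: (f z x - _) => X.
  rewrite [in RHS]gB gZ /= DB gB scalerBr.
  by rewrite !opprB [RHS]addrC subrKA addrC.
apply: (le_trans (nrmB _ _)); rewrite nrmN.
have B1 := le_trans (gc _) (ler_wpM2l (ltW c0) (H1 x)).
have B2 := le_trans (Dd _) (ler_wpM2l (ltW d0) H3).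
have {}B2 := le_trans (gc _) (ler_wpM2l (ltW c0) B2).
have {B2} := ler_wpM2l h0 B2; rewrite -nrmZ => B2.
have C1 : c * (e1 * cnrm h * nrm x) <= e / 2 * (cnrm h * nrm y).
  have -> : e / 2 * (cnrm h * nrm y) = c * (e1 * cnrm h * (2 * c * nrm y)).
    by rewrite /e1; field; rewrite gt_eqF.
  by rewrite ler_pM2l// ler_wpM2l// mulr_ge0// ltW.
have C2 : cnrm h * (c * (d * (c * (l * cnrm h * nrm x)))) <=
    e / 2 * (cnrm h * nrm y).
  apply: (@le_trans _ _
    (cnrm h * (c * (d * (c * (l * cnrm h * (2 * c * nrm y))))))).
    rewrite ler_wpM2l// (ler_pM2l c0) (ler_pM2l d0) (ler_pM2l c0) ler_wpM2l//.
    by rewrite mulr_ge0// ltW.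
  have := ler_wpM2r (mulr_ge0 h0 y0) hd.
  have -> : 4 * c ^+ 3 * d * l * cnrm h * (cnrm h * nrm y) =
    2 * (cnrm h * (c * (d * (c * (l * cnrm h * (2 * c * nrm y)))))) by ring.
  lra.
have := B1; have := B2; lra.
Unshelve. all: by end_near. Qed.

End NormDifferentiability.

(** * Resolutions of graphs *)
Section Resolutions.
Context {R : realType}.
Implicit Types U V W : normedModType R[i].

(** This is the composition rule with a constant outer family, whose derivative is zero; it serves
    to differentiate the components of a resolution. *)
Lemma has_norm_derivative_post U V W (P : V -> W) (T : R[i] -> U -> V)
    (z0 : R[i]^o) (E : U -> V) :
  linear P -> bounded_map P -> bounded_map (T z0) -> bounded_map E ->
  has_norm_derivative T z0 E ->
  has_norm_derivative (fun z => P \o T z) z0 (P \o E).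
Proof.
move=> lP bP bT bE TE.
have b0 : bounded_map (fun _ : V => 0 : W).
  by apply/bounded_mapP; exists 0 => x; rewrite nrm0 mul0r.
have l0 : linear (fun _ : V => 0 : W) by move=> a x y; rewrite scaler0 addr0.
have := has_norm_derivative_comp lP bP bT l0 b0 bE
  (has_norm_derivative_cst P z0) TE.
by congr has_norm_derivative; apply/funext => x /=; rewrite add0r.
Qed.

(** A constructor for resolutions given as plain functions: linearity is bundled pointwise by
    choice, and the range is closed because it is the graph of a closed operator. *)
Lemma differentiable_at_resolution V W (Theta Theta0 : set R[i]^o)
    (T : R[i] -> linop V W) (K : completeNormedModType R[i])
    (s : R[i] -> K -> (V * W)%type) (z0 : R[i]^o) (D : K -> (V * W)%type) :
  open Theta0 -> Theta0 z0 -> Theta0 `<=` Theta ->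
  (forall z, Theta0 z -> [/\ closed_op (T z), linear (s z),
     bounded_map (s z) & set_bij [set: K] (graph (T z)) (s z)]) ->
  linear D -> bounded_map D -> has_norm_derivative s z0 D ->
  differentiable_at Theta T z0.
Proof.
move=> oT Tz0 sT sP lD bD sD.
have : forall z, exists F : {linear K -> (V * W)%type}, Theta0 z -> F =1 s z.
  (* Outside [Theta0] the family need not be linear, so the zero map is used there; only values near
     [z0] affect the derivative. *)
  move=> z; have [Tz|nTz] := pselect (Theta0 z); last by exists \0.
  have [_ ls _ _] := sP _ Tz.
  by exists (HB.pack (s z) (GRing.isLinear.Build _ _ _ _ (s z) ls)
    : {linear K -> (V * W)%type}).
move=> /choice[r rs]; exists Theta0, K, r; split=> //.
  move=> z Tz; have [cT ls bs bij] := sP _ Tz.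
  have -> : (r z : K -> (V * W)%type) = s z by apply/funext; exact: rs.
  have [Ts Is Ss] := bij; split=> //.
    by move=> x y; apply: Is; rewrite inE.
  have -> // : range (s z) = graph (T z).
  by apply/seteqP; split=> [_ [k _ <-]|//]; exact: Ts.
apply: has_derivative_norm_differentiable lD bD _.
apply: has_norm_derivative_near_eq sD.
have := open_nbhs_nbhs (conj oT Tz0).
by apply: filterS => z; exact: rs.
Qed.

Lemma differentiable_atP V W (Theta : set R[i]^o) (T : R[i] -> linop V W)
    (z0 : R[i]^o) : differentiable_at Theta T z0 ->
  exists (Theta0 : set R[i]^o) (K : completeNormedModType R[i])
      (r : R[i] -> {linear K -> (V * W)%type})
      (D : {linear K -> (V * W)%type}),
    [/\ [/\ open Theta0, Theta0 z0 & Theta0 `<=` Theta],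
        forall z, Theta0 z -> [/\ bounded_map (r z), injective (r z) &
          range (r z) = graph (T z)],
        bounded_map D & has_norm_derivative r z0 D].
Proof.
move=> [Theta0 [K [r [oT Tz0 sT rP rD]]]].
have [|D [bD rD']] := norm_differentiable_has_derivative _ rD.
  have := open_nbhs_nbhs (conj oT Tz0); apply: filterS => z /rP[bz _ _ _].
  by split=> //; exact: linearP.
exists Theta0, K, r, D; split=> // z /rP[bz Iz _ [Tz _ Sz]]; split=> //.
by apply/seteqP; split=> [_ [k _ <-]|//]; exact: Tz.
Qed.

(** * Products with a bounded left factor *)

Lemma bounded_op_linear V W (T : linop V W) : bounded_op T -> linear T.
Proof. by move=> [dT _] a x y; rewrite fnP ?dT. Qed.

Lemma differentiable_comp_bounded (H1 H2 H : completeNormedModType R[i])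
    (Theta : set R[i]^o) (A : R[i] -> linop H H2) (B : R[i] -> linop H1 H)
    (z0 : R[i]^o) :
  open Theta -> Theta z0 -> (forall z, Theta z -> bounded_op (A z)) ->
  norm_differentiable_at A z0 -> differentiable_at Theta B z0 ->
  (forall z, Theta z -> closed_op (comp_op (A z) (B z))) ->
  differentiable_at Theta (fun z => comp_op (A z) (B z)) z0.
Proof.
move=> oTheta Tz0 bA dA /differentiable_atP dB cAB.
have [|DA [bDA AD]] := norm_differentiable_has_derivative _ dA.
  have := open_nbhs_nbhs (conj oTheta Tz0); apply: filterS => z /bA bAz.
  by split; [exact: bounded_op_linear|case: bAz].
have [T0 [K [r [D [[oT0 T0z0 sT0] rP bD rD]]]]] := dB.
have [bA0 lA0] : bounded_map (A z0) /\ linear (A z0).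
  by have bA0 := bA _ Tz0; split; [case: bA0|exact: bounded_op_linear].
have br0 : bounded_map (r z0) by case: (rP _ T0z0).
have lr z : linear (r z) by exact: linearP.
have lD : linear D by exact: linearP.
have lDA : linear DA by exact: linearP.
have bf := @bounded_fst R H1 H; have bs := @bounded_snd R H1 H.
have lf := @linear_fst R H1 H; have ls := @linear_snd R H1 H.
have F1 := has_norm_derivative_post lf bf br0 bD rD.
have F2 := has_norm_derivative_comp lA0 bA0 (bounded_comp bs br0) lDA bDA
  (bounded_comp bs bD) AD (has_norm_derivative_post ls bs br0 bD rD).
apply: (differentiable_at_resolution oT0 T0z0 sT0 _ _ _
  (has_norm_derivative_pair F1 F2)).
- move=> z T0z; have Tz := sT0 _ T0z.
  have [bAz lAz] := (bA _ Tz, bounded_op_linear (bA _ Tz)).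
  have [dAz bmA] := bAz; have [br Ir rg] := rP _ T0z.
  have rgr k : graph (B z) (r z k) by rewrite -rg; exists k.
  split.
  + exact: cAB.
  + apply: linear_pair_fun; first exact: linear_comp_fun.
    by apply: linear_comp_fun lAz _; exact: linear_comp_fun.
  + apply: bounded_pair; first exact: bounded_comp.
    by apply: bounded_comp bmA _; exact: bounded_comp.
  split.
  + move=> k _ /=; have [v Bv <-] := rgr k; exists v => //=.
    by split=> //; rewrite dAz.
  (* A point of the graph of [B z] is determined by its first component, so replacing the second one
     by its image under [A z] preserves injectivity. *)
  + move=> k k' _ _ [] /=; have [v Bv vk] := rgr k; have [v' Bv' vk'] := rgr k'.
    by rewrite -vk -vk' /= => vv' _; apply: Ir; rewrite -vk -vk' vv'.
  + move=> _ [v [Bv _] <-] /=.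
    have : graph (B z) (v, B z v) by exists v.
    by rewrite -rg => -[k _ kv]; exists k => //=; rewrite kv.
- apply: linear_pair_fun; first exact: linear_comp_fun.
  by apply: linear_add_fun; do 2![apply: linear_comp_fun => //].
- apply: bounded_pair; first exact: bounded_comp.
  by apply: bounded_add; do 2![apply: bounded_comp => //].
Qed.

(* The resolution [q z] of [B z] gives [(B z)^-1 = fst q z \o (snd q z)^-1]. *)
Lemma differentiable_closed_inv (H1 H : completeNormedModType R[i])
    (Theta : set R[i]^o) (B : R[i] -> linop H1 H) (z0 : R[i]^o) :
  (forall z, Theta z -> closed_inv_op (B z)) -> differentiable_at Theta B z0 ->
  exists (Theta0 : set R[i]^o) (b : R[i] -> H -> H1) (D : H -> H1),
    [/\ [/\ open Theta0, Theta0 z0 & Theta0 `<=` Theta],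
        forall z, Theta0 z -> [/\ linear (b z), bounded_map (b z) &
          forall y, dom (B z) (b z y) /\ B z (b z y) = y],
        linear D, bounded_map D & has_norm_derivative b z0 D].
Proof.
move=> iB /differentiable_atP[T0 [L [q [D [[oT0 T0z0 sT0] qP bD qD]]]]].
have lq z : linear (q z) by exact: linearP.
have lD : linear D by exact: linearP.
have bf := @bounded_fst R H1 H; have bs := @bounded_snd R H1 H.
have lf := @linear_fst R H1 H; have ls := @linear_snd R H1 H.
pose f z := snd \o q z; have lfz z : linear (f z) by exact: linear_comp_fun.
have bfz z : T0 z -> bounded_map (f z).
  by move=> /qP[bq _ _]; exact: bounded_comp.
have qB z k : T0 z -> dom (B z) (q z k).1 /\ B z (q z k).1 = f z k.
  move=> /qP[_ _ qg]; have : graph (B z) (q z k) by rewrite -qg; exists k.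
  by rewrite /f /= => -[v Bv <-].
(* Equal second components force equal first ones, as [B z] is injective; then [q z] is
   injective. *)
have fI z : T0 z -> injective (f z).
  move=> T0z k k' kk'; have [_ Iq _] := qP _ T0z.
  have [[Bk Ek] [Bk' Ek']] := (qB _ k T0z, qB _ k' T0z).
  have [_ IB _] := iB _ (sT0 _ T0z); apply: Iq.
  rewrite (surjective_pairing (q z k)) (surjective_pairing (q z k')).
  congr (_, _) => //; apply: IB; rewrite ?inE//.
  by rewrite Ek Ek'.
have fS z y : T0 z -> exists k, f z k = y.
  move=> T0z; have [_ _ /seteqP[_ /(_ y I)[v Bv <-]]] := iB _ (sT0 _ T0z).
  have [_ _ qg] := qP _ T0z.
  have : graph (B z) (v, B z v) by exists v.
  by rewrite -qg => -[k _ kv]; exists k; rewrite /f /= kv.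
have : forall z, exists g : H -> L, T0 z -> cancel g (f z).
  move=> z; have [T0z|nT0z] := pselect (T0 z); last by exists (fun=> 0).
  have /choice[g gP] : forall y, exists k, f z k = y by move=> y; exact: fS.
  by exists g.
move=> /choice[g gK].
have fK z : T0 z -> cancel (f z) (g z).
  by move=> T0z x; apply: (fI _ T0z); rewrite gK.
have lg z : T0 z -> linear (g z).
  by move=> T0z a x y; apply: (fI _ T0z); rewrite lfz !gK.
(* Completeness of the parameter space [L] and of [H] enters here, through the bounded inverse
   theorem. *)
have bg z : T0 z -> bounded_map (g z).
  move=> T0z; have [|C C0 fC] := bounded_inverse (lfz z) (bfz _ T0z) (fI _ T0z).
    by move=> y; exact: fS.
  by apply/bounded_mapP; exists C => y; rewrite -{2}(gK _ T0z y).
have bq z : T0 z -> bounded_map (q z) by case/qP.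
have nearK : \forall z \near z0, cancel (g z) (f z).
  by apply: filterS (open_nbhs_nbhs (conj oT0 T0z0)); exact: gK.
have fD := has_norm_derivative_post ls bs (bq _ T0z0) bD qD.
have lsD := linear_comp_fun ls lD; have bsD := bounded_comp bs bD.
have gD := has_norm_derivative_inverse (lfz z0) (lg _ T0z0) (bg _ T0z0)
  lsD bsD (fK _ T0z0) nearK fD.
have lg' : linear (fun y => - g z0 ((snd \o D) (g z0 y))).
  apply: linear_opp_fun; apply: linear_comp_fun; first exact: lg.
  by apply: linear_comp_fun => //; exact: lg.
have bg' : bounded_map (fun y => - g z0 ((snd \o D) (g z0 y))).
  apply: bounded_opp; apply: bounded_comp; first exact: bg.
  by apply: bounded_comp => //; exact: bg.
have pD := has_norm_derivative_post lf bf (bq _ T0z0) bD qD.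
have lfq z := linear_comp_fun lf (lq z).
have bfq z (T0z : T0 z) := bounded_comp bf (bq _ T0z).
have lfD := linear_comp_fun lf lD; have bfD := bounded_comp bf bD.
have bD' := has_norm_derivative_comp (lfq z0) (bfq _ T0z0) (bg _ T0z0)
  lfD bfD bg' pD gD.
eexists T0, (fun z y => (q z (g z y)).1), _; split; last exact: bD'.
- by split.
- move=> z T0z; split.
  + by apply: (linear_comp_fun (lfq z)); exact: lg.
  + by apply: (bounded_comp (bfq _ T0z)); exact: bg.
  by move=> y; have [? ->] := qB _ (g z y) T0z; rewrite gK.
- apply: linear_add_fun; last exact: (linear_comp_fun (lfq z0)).
  by apply: (linear_comp_fun lfD); exact: lg.
- apply: bounded_add; last exact: (bounded_comp (bfq _ T0z0)).
  by apply: (bounded_comp bfD); exact: bg.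
Qed.

(** * Products with an invertible right factor *)

Lemma differentiable_comp_inv (H1 H2 H : completeNormedModType R[i])
    (Theta : set R[i]^o) (A : R[i] -> linop H H2) (B : R[i] -> linop H1 H)
    (z0 : R[i]^o) :
  differentiable_at Theta A z0 ->
  (forall z, Theta z -> closed_inv_op (B z)) -> differentiable_at Theta B z0 ->
  (forall z, Theta z -> closed_op (comp_op (A z) (B z))) ->
  differentiable_at Theta (fun z => comp_op (A z) (B z)) z0.
Proof.
move=> /differentiable_atP[T1 [K [r [D [[oT1 T1z0 sT1] rP bD rD]]]]] iB dB cAB.
have [T2 [b [Db [[oT2 T2z0 sT2] bP lDb bDb bDD]]]] :=
  differentiable_closed_inv iB dB.
have [lb0 bb0 _] := bP _ T2z0.
have lr z : linear (r z) by exact: linearP.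
have lD : linear D by exact: linearP.
have br z : T1 z -> bounded_map (r z) by case/rP.
have bf := @bounded_fst R H H2; have bs := @bounded_snd R H H2.
have lf := @linear_fst R H H2; have ls := @linear_snd R H H2.
have F1 := has_norm_derivative_comp lb0 bb0 (bounded_comp bf (br _ T1z0))
  lDb bDb (bounded_comp bf bD) bDD
  (has_norm_derivative_post lf bf (br _ T1z0) bD rD).
have F2 := has_norm_derivative_post ls bs (br _ T1z0) bD rD.
apply: (differentiable_at_resolution (openI oT1 oT2) (conj T1z0 T2z0) _ _ _ _
  (has_norm_derivative_pair F1 F2)).
- by move=> z [/sT1].
- move=> z [T1z T2z]; have [lb bb bK] := bP _ T2z.
  have [brz Ir rg] := rP _ T1z; have Tz := sT1 _ T1z.
  have rgr k : graph (A z) (r z k) by rewrite -rg; exists k.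
  have [_ IB _] := iB _ Tz.
  split.
  + exact: cAB.
  + apply: linear_pair_fun; last exact: linear_comp_fun.
    by apply: (linear_comp_fun lb); exact: linear_comp_fun.
  + apply: bounded_pair; last exact: bounded_comp.
    by apply: (bounded_comp bb); exact: bounded_comp.
  split.
  + move=> k _ /=; have [y Ay <-] := rgr k; have [By yK] := bK y.
    by exists (b z y); [split=> //; rewrite yK|rewrite /= yK].
  (* Applying [B z] to the first component recovers [y], hence the whole point of the graph of
     [A z]. *)
  + move=> k k' _ _ [] /=; have [y Ay yk] := rgr k; have [y' Ay' yk'] := rgr k'.
    rewrite -yk -yk' /= => yy' _; apply: Ir; rewrite -yk -yk'.
    have [[_ yK] [_ yK']] := (bK y, bK y').
    by have -> : y = y' by rewrite -yK yy' yK'.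
  (* The parameter is that of the point of the graph of [A z] over [B z v]; injectivity of [B z]
     gives [b z (B z v) = v]. *)
  + move=> _ [v [Bv ABv] <-] /=.
    have : graph (A z) (B z v, A z (B z v)) by exists (B z v).
    rewrite -rg => -[k _ kv]; exists k => //=; rewrite kv /=; congr (_, _).
    by have [? ?] := bK (B z v); apply: IB; rewrite ?inE.
- apply: linear_pair_fun; last exact: linear_comp_fun.
  by apply: linear_add_fun; do 2![apply: linear_comp_fun => //].
- apply: bounded_pair; last exact: bounded_comp.
  apply: bounded_add; do 2![apply: bounded_comp => //]; exact: br.
Qed.

End Resolutions.

Theorem proposition5p2 (R : realType)
  (H1 H2 H : completeNormedModType R[i]) (Theta : set R[i]^o)
  (A : R[i] -> linop H H2) (B : R[i] -> linop H1 H) :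
  open Theta ->
  ([/\ forall z, Theta z -> bounded_op (A z),
       norm_holomorphic Theta A,
       forall z, Theta z -> closed_op (B z) &
       holomorphic Theta B]
   \/
   [/\ forall z, Theta z -> closed_op (A z),
       holomorphic Theta A,
       forall z, Theta z -> closed_inv_op (B z) &
       holomorphic Theta B]) ->
  (forall z, Theta z -> closed_op (comp_op (A z) (B z))) ->
  holomorphic Theta (fun z => comp_op (A z) (B z)).
Proof.
move=> oTheta [[bA dA _ dB]|[_ dA iB dB]] cAB z0 Tz0.
  by apply: differentiable_comp_bounded => //; [exact: dA|exact: dB].
by apply: differentiable_comp_inv => //; [exact: dA|exact: dB].
Qed.
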